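(* Let $\mathsf{M}$ be the class of all finite negative $\geq$-saturated bi-relation intuitionistic Kripke models satisfying (G1) and (G2). For every $\mathbf{MID}^-$-formula $\phi$: $\vdash_{\mathbf{MID}^-}\phi$ if and only if $\mathfrak{M},w\Vdash\phi$ for every $\mathfrak{M}\in\mathsf{M}$ and every point $w$ of $\mathfrak{M}$.
   Context: **Language of $\mathbf{MID}^-$.** Fix a set $\mathrm{Prop}$ of propositional variables. Formulas: $\phi::=p\mid\bot\mid\phi\wedge\phi\mid\phi\vee\phi\mid\phi\to\phi\mid\Box\phi\mid\Diamond\phi$. Classical formulas are the $\vee$-free ones. $\neg\phi$ abbreviates $\phi\to\bot$. **Hilbert system of $\mathbf{MID}^-$.** Axioms: all instances ($\phi,\psi,\chi$ arbitrary formulas, $\alpha$ classical) of 1. $\phi\to(\psi\to\phi)$; $(\phi\to(\psi\to\chi))\to((\phi\to\psi)\to(\phi\to\chi))$; $\phi\wedge\psi\to\phi$; $\phi\wedge\psi\to\psi$; $\phi\to(\chi\to(\phi\wedge\chi))$; $\phi\to\phi\vee\psi$; $\psi\to\phi\vee\psi$; $(\phi\to\chi)\to((\psi\to\chi)\to(\phi\vee\psi\to\chi))$; $\bot\to\phi$; 2. $(\alpha\to(\phi\vee\psi))\to(\alpha\to\phi)\vee(\alpha\to\psi)$; $\neg\neg\alpha\to\alpha$; 3. $\Box(\phi\to\psi)\to(\Box\phi\to\Box\psi)$; $\Box(\phi\to\psi)\to(\Diamond\phi\to\Diamond\psi)$; $\neg\Diamond\bot$; $\Diamond(\phi\vee\psi)\to(\Diamond\phi\vee\Diamond\psi)$;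 $(\Diamond\phi\to\Box\psi)\to\Box(\phi\to\psi)$; 4. $\neg\Box\alpha\to\Diamond\neg\alpha$; $\Box(\phi\vee\psi)\to(\Box\phi\vee\Box\psi)$. Rules: Modus Ponens and Necessitation $\phi/\Box\phi$ (no uniform substitution). $\vdash_{\mathbf{MID}^-}\phi$ means $\phi$ is a theorem. **Bi-relation intuitionistic Kripke models.** A frame is $(W,\geq,R)$ with $W\ne\emptyset$, $\geq$ a partial order on $W$, $R\subseteq W\times W$ such that (F1) if $w\geq w'$ and $wRv$, then there is $v'$ with $v\geq v'$ and $w'Rv'$; (F2) if $wRv$ and $v\geq v'$, then there is $w'$ with $w\geq w'$ and $w'Rv'$. A model $\mathfrak{M}=(W,\geq,R,V)$ adds $V:\mathrm{Prop}\to\wp(W)$ with: $w\in V(p)$ and $w\geq v$ imply $v\in V(p)$. Satisfaction at points: $w\Vdash p$ iff $w\in V(p)$; $w\nVdash\bot$; $\wedge,\vee$ pointwise as usual; $w\Vdash\phi\to\psi$ iff for all $v$ with $w\geq v$, $v\Vdash\phi$ implies $v\Vdash\psi$; $w\Vdash\Diamond\phi$ iff there is $v$ with $wRv$ and $v\Vdash\phi$; $w\Vdash\Box\phi$ iff $v\Vdash\phi$ for all $u,v$ with $w\geq u$ and $uRv$. **Conditions.** For $A\subseteq W$, $R(A)=\{v\mid\exists a\in A,\ aRv\}$ and $R(w)=R(\{w\})$; $(\geq\circ R)(w)=\{v\mid\exists z,\ w\geq z\text{ and }zRv\}$. $w$ is an $\geq$-endpoint if there is no $v\ne w$ with $w\geq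 v$. $E_w=\{v\mid w\geq v,\ v\text{ an }\geq\text{-endpoint}\}$. - $\geq$-saturated: for every $w$, $E_w\neq\emptyset$, and for every nonempty $E\subseteq E_w$ there is $v$ with $w\geq v$ and $E_v=E$. - Negative: for every $w$ and every $p\in\mathrm{Prop}$, $w\Vdash p$ iff $w\Vdash\neg\neg p$. - (G1): for any $w$ and any nonempty finite $X\subseteq(\geq\circ R)(w)$ there is $u\in(\geq\circ R)(w)$ with $u\geq v$ for all $v\in X$. - (G2): for any $w$ and any set $E$ of $\geq$-endpoints with $E\subseteq R(E_w)$ and $E\cap R(v)\neq\emptyset$ for every $v\in E_w$, there is $t$ with $wRt$ and $E_t\subseteq E$. - Finite: $W$ is finite. *)

(* Defs.v *)
From mathcomp Require Import all_boot.
From mathcomp Require Import boolp classical_sets cardinality.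

Set Implicit Arguments.
Unset Strict Implicit.
Unset Printing Implicit Defensive.

Local Open Scope classical_set_scope.

Inductive formula (Var : Type) : Type :=
| Atom of Var
| Bot
| And of formula Var & formula Var
| Or of formula Var & formula Var
| Imp of formula Var & formula Var
| Box of formula Var
| Dia of formula Var.

Arguments Bot {Var}.

Declare Scope formula_scope.
Delimit Scope formula_scope with F.
Bind Scope formula_scope with formula.

Definition Neg (Var : Type) (phi : formula Var) : formula Var := Imp phi Bot.

Notation "⊥" := Bot (at level 0) : formula_scope.
Notation "¬ phi" := (Neg phi) (at level 35, right associativity) : formula_scope.
Notation "□ phi" := (Box phi) (at level 35, right associativity) : formula_scope.
Notation "◇ phi" := (Dia phi) (at level 35, right associativity) : formula_scope.
Notation "phi ∧ psi" := (And phi psi) (at level 40, left associativity) : formula_scope.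
Notation "phi ∨ psi" := (Or phi psi) (at level 50, left associativity) : formula_scope.
Notation "phi ⇒ psi" := (Imp phi psi) (at level 55, right associativity) : formula_scope.

Fixpoint classical (Var : Type) (phi : formula Var) : bool :=
  match phi with
  | Atom _ | Bot => true
  | And phi psi | Imp phi psi => classical phi && classical psi
  | Or _ _ => false
  | Box phi | Dia phi => classical phi
  end.

Inductive MIDm_axiom (Var : Type) : formula Var -> Prop :=
| ax_K phi psi : MIDm_axiom (phi ⇒ (psi ⇒ phi))
| ax_S phi psi chi :
    MIDm_axiom ((phi ⇒ (psi ⇒ chi)) ⇒ ((phi ⇒ psi) ⇒ (phi ⇒ chi)))
| ax_andl phi psi : MIDm_axiom (phi ∧ psi ⇒ phi)
| ax_andr phi psi : MIDm_axiom (phi ∧ psi ⇒ psi)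
| ax_and phi chi : MIDm_axiom (phi ⇒ (chi ⇒ phi ∧ chi))
| ax_orl phi psi : MIDm_axiom (phi ⇒ phi ∨ psi)
| ax_orr phi psi : MIDm_axiom (psi ⇒ phi ∨ psi)
| ax_or phi psi chi :
    MIDm_axiom ((phi ⇒ chi) ⇒ ((psi ⇒ chi) ⇒ (phi ∨ psi ⇒ chi)))
| ax_bot phi : MIDm_axiom (⊥ ⇒ phi)
| ax_split alpha phi psi : classical alpha ->
    MIDm_axiom ((alpha ⇒ phi ∨ psi) ⇒ (alpha ⇒ phi) ∨ (alpha ⇒ psi))
| ax_dne alpha : classical alpha -> MIDm_axiom (¬ ¬ alpha ⇒ alpha)
| ax_box_imp phi psi : MIDm_axiom (□ (phi ⇒ psi) ⇒ (□ phi ⇒ □ psi))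
| ax_dia_imp phi psi : MIDm_axiom (□ (phi ⇒ psi) ⇒ (◇ phi ⇒ ◇ psi))
| ax_dia_bot : MIDm_axiom (¬ ◇ ⊥)
| ax_dia_or phi psi : MIDm_axiom (◇ (phi ∨ psi) ⇒ ◇ phi ∨ ◇ psi)
| ax_dia_box phi psi : MIDm_axiom ((◇ phi ⇒ □ psi) ⇒ □ (phi ⇒ psi))
| ax_nbox alpha : classical alpha -> MIDm_axiom (¬ □ alpha ⇒ ◇ ¬ alpha)
| ax_box_or phi psi : MIDm_axiom (□ (phi ∨ psi) ⇒ □ phi ∨ □ psi).

Inductive MIDm (Var : Type) : formula Var -> Prop :=
| MIDm_ax phi : MIDm_axiom phi -> MIDm phi
| MIDm_mp phi psi : MIDm (phi ⇒ psi)%F -> MIDm phi -> MIDm psi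
| MIDm_nec phi : MIDm phi -> MIDm (□ phi)%F.

Record frame : Type := Frame {
  world :> Type;
  world_nonempty : [set: world] !=set0;
  (* [above w v] is w >= v: the order points downwards, so the intuitionistic
     "future" states of w are those below it. *)
  above : world -> world -> Prop;
  above_refl : forall w, above w w;
  above_trans : forall w v u, above w v -> above v u -> above w u;
  above_antisym : forall w v, above w v -> above v w -> w = v;
  acc : world -> world -> Prop;
  frame_F1 : forall w w' v,
    above w w' -> acc w v -> exists2 v', above v v' & acc w' v';
  frame_F2 : forall w v v',
    acc w v -> above v v' -> exists2 w', above w w' & acc w' v'
}.

Arguments above {f} w v.
Arguments acc {f} w v.

Record model (Var : Type) : Type := Model {
  model_frame :> frame;
  valuation : Var -> set model_frame;
  val_persistent : forall p w v, valuation p w -> above w v -> valuation p v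
}.

Arguments valuation {Var} m p.

Fixpoint sat (Var : Type) (M : model Var) (w : M) (phi : formula Var) : Prop :=
  match phi with
  | Atom p => valuation M p w
  | Bot => False
  | And phi psi => sat w phi /\ sat w psi
  | Or phi psi => sat w phi \/ sat w psi
  | Imp phi psi => forall v : M, above w v -> sat v phi -> sat v psi
  | Dia phi => exists2 v : M, acc w v & sat v phi
  | Box phi => forall u v : M, above w u -> acc u v -> sat v phi
  end.

Section Conditions.
Variable F : frame.

Definition acc_set (A : set F) : set F := [set v | exists2 a, A a & acc a v].

Definition above_acc (w : F) : set F := [set v | exists2 z, above w z & acc z v].

Definition endpoint (w : F) : Prop := ~ exists2 v, v <> w & above w v.

Definition endpoints_below (w : F) : set F := [set v | above w v /\ endpoint v].

Definition saturated : Prop :=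
  forall w : F, endpoints_below w !=set0 /\
    forall E : set F, E !=set0 -> E `<=` endpoints_below w ->
      exists2 v, above w v & endpoints_below v = E.

Definition cond_G1 : Prop :=
  forall (w : F) (X : set F), X !=set0 -> finite_set X -> X `<=` above_acc w ->
    exists2 u, above_acc w u & forall v, X v -> above u v.

Definition cond_G2 : Prop :=
  forall (w : F) (E : set F), E `<=` endpoint ->
    E `<=` acc_set (endpoints_below w) ->
    (forall v, endpoints_below w v -> E `&` acc_set [set v] !=set0) ->
    exists2 t, acc w t & endpoints_below t `<=` E.

Definition finite_frame : Prop := finite_set [set: F].

End Conditions.

Definition negative (Var : Type) (M : model Var) : Prop :=
  forall (w : M) (p : Var), sat w (Atom p) <-> sat w (¬ ¬ Atom p).

Definition class_M (Var : Type) : set (model Var) :=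
  [set M : model Var | [/\ finite_frame M, negative M, saturated M, cond_G1 M & cond_G2 M]].

(* Main.v *)
(* Soundness rests on two facts about the class: a classical formula holds at w
   as soon as it holds at all endpoints below w, and truth of any formula passes
   from v to u whenever E_u is included in E_v.

   For completeness, the axioms for disjunction rewrite every formula into an
   equivalent disjunction of classical formulas.  On classical formulas the
   logic is the classical modal logic K, so each unprovable disjunct fails in a
   maximal consistent set.  Filtrating the canonical Kripke model through the
   subformulas of the disjunction gives a finite set of states; its nonempty
   subsets ("teams"), ordered by inclusion and related by the Egli-Milner
   lifting, form a model of the class.  A team supports a classical formula iff
   all its members do, so by persistence the team of all the refuting states
   refutes the whole disjunction. *)
From HB Require Import structures.
Require Import Defs.
From mathcomp Require Import all_boot.
From mathcomp Require Import boolp classical_sets cardinality.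

Set Implicit Arguments.
Unset Strict Implicit.
Unset Printing Implicit Defensive.

Local Open Scope classical_set_scope.
Local Open Scope formula_scope.

(** * Soundness: persistence, endpoints and the axioms *)

Lemma sat_persistent (Var : Type) (M : model Var) (w v : M) (a : formula Var) :
  above w v -> sat w a -> sat v a.
Proof.
elim: a w v => [p||a IHa b IHb|a IHa b IHb|a IHa b IHb|a IHa|a IHa] w v wv //=.
- by move=> pw; apply: val_persistent wv.
- by case=> /(IHa _ _ wv) ? /(IHb _ _ wv).
- by case=> [/(IHa _ _ wv)|/(IHb _ _ wv)]; [left|right].
- by move=> ab u /(above_trans wv); exact: ab.
- by move=> ha u t /(above_trans wv); exact: ha.
- case=> t wt ha; have [t' tt' vt'] := frame_F1 wv wt.
  by exists t' => //; exact: IHa tt' ha.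
Qed.

Lemma endpoint_eq (F : frame) (e v : F) : endpoint e -> above e v -> v = e.
Proof. by move=> he ev; apply: contrapT => ne; apply: he; exists v. Qed.

Lemma endpoint_acc_below (F : frame) (e t x : F) :
  endpoint e -> acc e t -> above t x -> acc e x.
Proof. by move=> he et /(frame_F2 et)[e' /(endpoint_eq he) ->]. Qed.

Lemma endpoints_below_trans (F : frame) (w v e : F) :
  above w v -> endpoints_below v e -> endpoints_below w e.
Proof. by move=> wv [ve ?]; split=> //; exact: above_trans ve. Qed.

(** (F1) carries the step from [w] to [t] down to [e], reaching some [t'] below [t]. Since [e] is an
    endpoint, (F2) then makes every point below [t'] accessible from [e] itself. *)
Lemma endpoint_successor (F : frame) (w t e : F) : saturated F ->
  acc w t -> endpoints_below w e -> exists2 x, endpoints_below t x & acc e x.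
Proof.
move=> satF wt [we he]; have [t' tt' et'] := frame_F1 we wt.
have [[x Ex] _] := satF t'; exists x; first exact: endpoints_below_trans Ex.
by apply: endpoint_acc_below he et' _; case: Ex.
Qed.

Lemma endpoint_predecessor (F : frame) (w x : F) : saturated F ->
  above_acc w x -> endpoint x -> exists2 e, endpoints_below w e & acc e x.
Proof.
move=> satF [z wz zx] hx; have [[e [ze he]] _] := satF z.
exists e; first by split=> //; exact: above_trans ze.
by have [x' /(endpoint_eq hx) ->] := frame_F1 ze zx.
Qed.

Lemma above_acc_below (F : frame) (w v x : F) :
  above_acc w v -> above v x -> above_acc w x.
Proof.
move=> [z wz zv] /(frame_F2 zv)[z' zz' z'x].
by exists z' => //; exact: above_trans zz'.
Qed.

(** Negativity settles atoms. For boxes, each endpoint below a point of [above_acc w] is already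
    accessible from an endpoint below [w]. For diamonds, (G2) assembles one successor of [w] from
    successors of the endpoints. *)
Lemma sat_flat (Var : Type) (M : model Var) (w : M) (a : formula Var) :
  class_M M -> classical a -> (forall e, endpoints_below w e -> sat e a) ->
  sat w a.
Proof.
case=> _ negM satM _ G2M.
elim: a w => [p||a IHa b IHb|a _ b _|a IHa b IHb|a IHa|a IHa] w //=.
- move=> _ hw; apply/negM => v wv nv; have [[e Ee] _] := satM v.
  apply: (nv e Ee.1); exact: hw (endpoints_below_trans wv Ee).
- by move=> _ hw; have [[e /hw]] := satM w.
- move=> /andP[ca cb] hw.
  by split; [apply: IHa => // e /hw[]|apply: IHb => // e /hw[]].
- move=> /andP[ca cb] hw v wv va; apply: IHb => // e ve.
  apply: hw (endpoints_below_trans wv ve) _ (above_refl _) _.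
  exact: sat_persistent ve.1 va.
- move=> ca hw u v wu uv; apply: IHa => // x [vx hx].
  have [|e Ee ex] := endpoint_predecessor (w := w) satM _ hx.
    by apply: above_acc_below vx; exists u.
  exact: hw Ee _ _ (above_refl e) ex.
- move=> ca hw.
  (* The set given to (G2) keeps only endpoints satisfying [a], so the successor [t] it yields has
     [a] at all its endpoints. It meets the successors of each [v]: any endpoint below a witness of
     the diamond at [v] is accessible from [v]. *)
  have [||v vw|t wt Et] :=
    G2M w [set x | [/\ endpoint x, acc_set (endpoints_below w) x & sat x a]].
  + by move=> x [].
  + by move=> x [].
  + have [y vy ya] := hw v vw; have [[x [yx hx]] _] := satM y.
    have vx : acc v x by apply: endpoint_acc_below yx => //; exact: vw.2.
    exists x; split; last by exists v.
    by split=> //; [exists v|exact: sat_persistent ya].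
  + by exists t => //; apply: IHa => // x /Et[].
Qed.

(** Truth depends only on the set of endpoints below a point and is antitone in it. Saturation, (G1)
    and (G2) serve the cases of implication, box and diamond respectively. *)
Lemma sat_endpoints_subset (Var : Type) (M : model Var) (v u : M)
    (a : formula Var) : class_M M ->
  endpoints_below u `<=` endpoints_below v -> sat v a -> sat u a.
Proof.
move=> cM; case: (cM) => finM negM satM G1M G2M.
elim: a v u => [p||a IHa b IHb|a IHa b IHb|a IHa b IHb|a IHa|a IHa] v u uv.
- move=> pv; apply: (sat_flat (a := Atom p)) => // e /uv[ve _].
  exact: sat_persistent ve pv.
- by [].
- by case=> /(IHa _ _ uv) ? /(IHb _ _ uv).
- by case=> [/(IHa _ _ uv)|/(IHb _ _ uv)]; [left|right].
- move=> /= ab u' uu' ua.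
  (* Saturation gives [v'] below [v] with exactly the endpoints of [u'], so the induction hypotheses
     carry [a] from [u'] to [v'] and [b] back. *)
  have [//||v' vv' Ev'] := (satM v).2 (endpoints_below u').
  + by have [] := satM u'.
  + by move=> e Ee; apply/uv; exact: endpoints_below_trans Ee.
  + apply: (IHb v'); rewrite ?Ev' //; apply: ab => //.
    by apply: (IHa u'); rewrite ?Ev'.
- move=> /= va u' t uu' u't.
  have Et : endpoints_below t `<=` above_acc v.
    move=> x [tx hx].
    have [|e /uv[ve _] ex] := endpoint_predecessor (w := u) satM _ hx.
      by apply: above_acc_below tx; exists u'.
    by exists e.
  (* (G1), applied to the endpoints below [t], gives a point [z] over all of them at which the box
     at [v] guarantees [a]. *)
  have [||z [v' vv' v'z] zt] := G1M v _ _ _ Et.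
  + by have [] := satM t.
  + by apply: sub_finite_set finM.
  + apply: (IHa z); last exact: va vv' v'z.
    by move=> x tx; split; [exact: zt|exact: tx.2].
- move=> /= [t vt ta].
  (* Cutting the endpoints of [t] down to those accessible from endpoints of [u] meets the premises
     of (G2). The resulting [t'] has its endpoints among those of [t]. *)
  have [||e Ee|t' ut' Et'] :=
    G2M u (endpoints_below t `&` acc_set (endpoints_below u)).
  + by move=> x [[]].
  + by move=> x [].
  + have [x tx ex] := endpoint_successor satM vt (uv _ Ee).
    by exists x; split; [split=> //; exists e|exists e].
  + by exists t' => //; apply: IHa ta => x /Et'[].
Qed.

Lemma sat_axiom (Var : Type) (a : formula Var) : MIDm_axiom a ->
  forall M : model Var, class_M M -> forall w : M, sat w a.
Proof.
move=> ax M cM w; case: (cM) => finM negM satM G1M G2M.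
case: ax => {a} [a b|a b c|a b|a b|a b|a b|a b|a b c|a|a b c ca|a ca|a b|a b||
  a b|a b|a ca|a b] /=.
- by move=> v wv va u vu _; exact: sat_persistent va.
- move=> v wv abc u vu ab t ut ta.
  exact: abc (above_trans vu ut) ta _ (above_refl t) (ab t ut ta).
- by move=> v _ [].
- by move=> v _ [].
- by move=> v wv va u vu ub; split=> //; exact: sat_persistent va.
- by left.
- by right.
- move=> v wv ac u vu bc t ut [ta|tb]; last exact: bc.
  by apply: ac ta; exact: above_trans ut.
- by [].
- move=> v wv abc.
  (* If some endpoint below [v] satisfies [a], saturation gives [u] whose endpoints are exactly
     those satisfying [a]. This [u] decides between the disjuncts, and every [t] below [v]
     satisfying [a] has its endpoints among those of [u]. Otherwise [a] fails everywhere below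
     [v]. *)
  case: (pselect (exists2 e, endpoints_below v e & sat e a)) => [[e0 ve0 e0a]|na].
    have [|x []//|u vu Eu] :=
      (satM v).2 [set e | endpoints_below v e /\ sat e a].
      by exists e0.
    have ua : sat u a by apply: sat_flat => // e; rewrite Eu => -[].
    have sub t : above v t -> sat t a -> endpoints_below t `<=` endpoints_below u.
      move=> vt ta e te; rewrite Eu; split; last exact: sat_persistent te.1 ta.
      exact: endpoints_below_trans te.
    case: (abc u vu ua) => [ub|uc]; [left|right] => t vt ta.
      exact: sat_endpoints_subset (sub t vt ta) ub.
    exact: sat_endpoints_subset (sub t vt ta) uc.
  left=> t vt ta; exfalso; apply: na; have [[e te] _] := satM t.
  exists e; first exact: endpoints_below_trans te.
  exact: sat_persistent te.1 ta.
- move=> v wv nna; apply: sat_flat => // e [ve he].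
  apply: contrapT => nea; apply: (nna e) => // u eu ua.
  by apply: nea; rewrite -(endpoint_eq he eu).
- move=> v wv ab u vu ua s t us st.
  exact: ab (above_trans vu us) st _ (above_refl t) (ua s t us st).
- move=> v wv ab u vu [t ut ta]; exists t => //.
  exact: ab vu ut _ (above_refl _) ta.
- by move=> v wv [].
- by move=> v wv [t vt [ta|tb]]; [left|right]; exists t.
- move=> v wv ab u t vu ut t' tt' t'a.
  have [u' uu' u't'] := frame_F2 ut tt'.
  have u'a : exists2 x, acc u' x & sat x a by exists t'.
  exact: ab (above_trans vu uu') u'a u' t' (above_refl u') u't'.
(* The conclusion is itself classical, so it may be checked at an endpoint [e], whose only lower
   point is [e]. *)
- move=> v wv nba; apply: (sat_flat (a := ◇ ¬ a)) => /=; rewrite ?andbT//.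
  move=> e [ve he]; apply: contrapT => nd; apply: (nba e ve) => u t eu et.
  rewrite (endpoint_eq he eu) in et.
  apply: sat_flat => // x [tx hx]; apply: contrapT => nxa; apply: nd.
  exists x; first exact: endpoint_acc_below tx.
  by move=> y /(endpoint_eq hx) ->.
- move=> v wv ab; apply: contrapT => /not_orP[na nb].
  have wit c : ~ (forall s t, above v s -> acc s t -> sat t c) ->
      exists2 t : M, above_acc v t & ~ sat t c.
    move=> nc; apply: contrapT => nex; apply: nc => s t vs st.
    by apply: contrapT => ntc; apply: nex; exists t => //; exists s.
  have [t1 vt1 t1a] := wit _ na; have [t2 vt2 t2b] := wit _ nb.
  (* The point [u] lies above counterexamples to both disjuncts, so by persistence it can satisfy
     neither. *)
  have [|||u [s vs su] uX] := G1M v [set t1; t2].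
  + by exists t1; left.
  + exact: finite_set2.
  + by move=> x [] ->.
  + case: (ab s u vs su) => [ua|ub].
      by apply: t1a; apply: sat_persistent ua; apply: uX; left.
    by apply: t2b; apply: sat_persistent ub; apply: uX; right.
Qed.

Lemma soundness (Var : Type) (a : formula Var) : MIDm a ->
  forall M : model Var, class_M M -> forall w : M, sat w a.
Proof.
move=> + M cM; elim=> {a} [a ax|a b _ IHab _ IHa|a _ IHa] w /=.
- exact: sat_axiom.
- exact: IHab (above_refl w) (IHa w).
- by move=> *; exact: IHa.
Qed.

(** * Derivations from hypotheses and derived rules *)

Inductive derives (Var : Type) (X : set (formula Var)) : formula Var -> Prop :=
| derives_thm a : MIDm a -> derives X a
| derives_hyp a : X a -> derives X a
| derives_mp a b : derives X (a ⇒ b) -> derives X a -> derives X b.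

Lemma derives_ax (Var : Type) (X : set (formula Var)) (a : formula Var) :
  MIDm_axiom a -> derives X a.
Proof. by move=> ?; apply/derives_thm/MIDm_ax. Qed.

Lemma derives_sub (Var : Type) (X Y : set (formula Var)) (a : formula Var) :
  X `<=` Y -> derives X a -> derives Y a.
Proof.
move=> XY; elim=> {a} [a|a /XY|a b _ IHab _ IHa].
- exact: derives_thm.
- exact: derives_hyp.
- exact: derives_mp IHab IHa.
Qed.

Lemma derives_set0 (Var : Type) (a : formula Var) : derives set0 a -> MIDm a.
Proof. by elim=> {a} // a b _ IHab _ IHa; exact: MIDm_mp IHab IHa. Qed.

(** The deduction theorem holds without side conditions because [derives] confines necessitation to
    theorems. *)
Lemma derives_imp (Var : Type) (X : set (formula Var)) (a b : formula Var) :
  derives (a |` X) b -> derives X (a ⇒ b).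
Proof.
have weak c : derives X c -> derives X (a ⇒ c).
  by apply: derives_mp; apply: derives_ax; constructor.
elim=> {b} [b ?|b [->|?]|b c _ IHbc _ IHb].
- exact/weak/derives_thm.
- apply: derives_mp (derives_ax _ (ax_K a a)).
  by apply: derives_mp (derives_ax _ (ax_K a (a ⇒ a))); apply/derives_ax/ax_S.
- exact/weak/derives_hyp.
- by apply: derives_mp IHb; apply: derives_mp IHbc; apply/derives_ax/ax_S.
Qed.

Definition entails (Var : Type) (a b : formula Var) := MIDm (a ⇒ b).

Lemma entailsP (Var : Type) (a b : formula Var) :
  derives [set a] b <-> entails a b.
Proof.
split=> [ab|ab]; last exact: derives_mp (derives_thm _ ab) (derives_hyp _).
by apply: derives_set0; apply: derives_imp; rewrite setU0.
Qed.

Lemma entails_refl (Var : Type) (a : formula Var) : entails a a.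
Proof. by apply/entailsP/derives_hyp. Qed.

Lemma entails_trans (Var : Type) (b a c : formula Var) :
  entails a b -> entails b c -> entails a c.
Proof.
by move=> /entailsP ab bc; apply/entailsP/(derives_mp _ ab)/derives_thm.
Qed.

Lemma entails_and (Var : Type) (a b c : formula Var) :
  entails c a -> entails c b -> entails c (a ∧ b).
Proof.
move=> /entailsP ca /entailsP cb; apply/entailsP.
by apply/(derives_mp _ cb)/(derives_mp _ ca)/derives_ax/ax_and.
Qed.

Lemma entails_andl (Var : Type) (a b : formula Var) : entails (a ∧ b) a.
Proof. exact/MIDm_ax/ax_andl. Qed.

Lemma entails_andr (Var : Type) (a b : formula Var) : entails (a ∧ b) b.
Proof. exact/MIDm_ax/ax_andr. Qed.

Lemma entails_or (Var : Type) (a b c : formula Var) :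
  entails a c -> entails b c -> entails (a ∨ b) c.
Proof. by move=> ac; apply/MIDm_mp/(MIDm_mp _ ac)/MIDm_ax/ax_or. Qed.

Lemma entails_orl (Var : Type) (a b : formula Var) : entails a (a ∨ b).
Proof. exact/MIDm_ax/ax_orl. Qed.

Lemma entails_orr (Var : Type) (a b : formula Var) : entails b (a ∨ b).
Proof. exact/MIDm_ax/ax_orr. Qed.

Lemma entails_curry (Var : Type) (a b c : formula Var) :
  entails (a ∧ b) c <-> entails a (b ⇒ c).
Proof.
split=> h; apply/entailsP.
  apply/derives_imp/(derives_mp (derives_thm _ h)).
  apply: derives_mp (derives_hyp (a := b) _); last by left.
  apply: derives_mp (derives_hyp (a := a) _); last by right.
  exact/derives_ax/ax_and.
have pa := (entailsP _ _).2 (entails_andl a b).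
have pb := (entailsP _ _).2 (entails_andr a b).
exact/(derives_mp _ pb)/(derives_mp _ pa)/derives_thm.
Qed.

Lemma entails_imp (Var : Type) (a a' b b' : formula Var) :
  entails a' a -> entails b b' -> entails (a ⇒ b) (a' ⇒ b').
Proof.
move=> a'a bb'; apply/entails_curry/(entails_trans _ bb').
have ev : entails ((a ⇒ b) ∧ a) b by apply/entails_curry/entails_refl.
apply: entails_trans ev; apply: entails_and; first exact: entails_andl.
exact: entails_trans (entails_andr _ _) a'a.
Qed.

Lemma entails_box (Var : Type) (a b : formula Var) :
  entails a b -> entails (□ a) (□ b).
Proof. by move=> /MIDm_nec; apply/MIDm_mp/MIDm_ax/ax_box_imp. Qed.

Lemma entails_dia (Var : Type) (a b : formula Var) :
  entails a b -> entails (◇ a) (◇ b).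
Proof. by move=> /MIDm_nec; apply/MIDm_mp/MIDm_ax/ax_dia_imp. Qed.

(** * Provable equivalence and disjunctive normal forms *)

Definition equivalent (Var : Type) (a b : formula Var) :=
  entails a b /\ entails b a.

Lemma equivalent_trans (Var : Type) (b a c : formula Var) :
  equivalent a b -> equivalent b c -> equivalent a c.
Proof. by move=> [ab ba] [bc cb]; split; exact: (@entails_trans _ b). Qed.

Lemma equivalent_and (Var : Type) (a a' b b' : formula Var) :
  equivalent a a' -> equivalent b b' -> equivalent (a ∧ b) (a' ∧ b').
Proof.
by move=> [aa' a'a] [bb' b'b]; split; apply: entails_and;
  by [apply: entails_trans (entails_andl _ _) _
     |apply: entails_trans (entails_andr _ _) _].
Qed.

Lemma equivalent_or (Var : Type) (a a' b b' : formula Var) :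
  equivalent a a' -> equivalent b b' -> equivalent (a ∨ b) (a' ∨ b').
Proof.
by move=> [aa' a'a] [bb' b'b]; split; apply: entails_or;
  by [apply: entails_trans (entails_orl _ _)
     |apply: entails_trans (entails_orr _ _)].
Qed.

Lemma equivalent_imp (Var : Type) (a a' b b' : formula Var) :
  equivalent a a' -> equivalent b b' -> equivalent (a ⇒ b) (a' ⇒ b').
Proof. by move=> [? ?] [? ?]; split; exact: entails_imp. Qed.

Lemma equivalent_box (Var : Type) (a b : formula Var) :
  equivalent a b -> equivalent (□ a) (□ b).
Proof. by case=> ? ?; split; exact: entails_box. Qed.

Lemma equivalent_dia (Var : Type) (a b : formula Var) :
  equivalent a b -> equivalent (◇ a) (◇ b).
Proof. by case=> ? ?; split; exact: entails_dia. Qed.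

Lemma and_comm (Var : Type) (a b : formula Var) :
  entails (a ∧ b) (b ∧ a).
Proof. by apply: entails_and; [exact: entails_andr|exact: entails_andl]. Qed.

Lemma equivalent_and_orl (Var : Type) (a b c : formula Var) :
  equivalent ((a ∨ b) ∧ c) (a ∧ c ∨ b ∧ c).
Proof.
split.
  by apply/entails_curry/entails_or; apply/entails_curry;
    [exact: entails_orl|exact: entails_orr].
apply: entails_or; apply: entails_and; try exact: entails_andr;
  apply: entails_trans (entails_andl _ _) _;
  [exact: entails_orl|exact: entails_orr].
Qed.

Lemma equivalent_and_orr (Var : Type) (a b c : formula Var) :
  equivalent (a ∧ (b ∨ c)) (a ∧ b ∨ a ∧ c).
Proof.
apply: (equivalent_trans (b := (b ∨ c) ∧ a)); first by split; exact: and_comm.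
apply: equivalent_trans (equivalent_and_orl b c a) _.
by apply: equivalent_or; split; exact: and_comm.
Qed.

Lemma equivalent_imp_orl (Var : Type) (a b c : formula Var) :
  equivalent (a ∨ b ⇒ c) ((a ⇒ c) ∧ (b ⇒ c)).
Proof.
split; last exact/entails_curry/MIDm_ax/ax_or.
apply: entails_and; apply: entails_imp (entails_refl _);
  [exact: entails_orl|exact: entails_orr].
Qed.

Lemma equivalent_imp_orr (Var : Type) (a b c : formula Var) : classical a ->
  equivalent (a ⇒ b ∨ c) ((a ⇒ b) ∨ (a ⇒ c)).
Proof.
move=> ca; split; first exact/MIDm_ax/ax_split.
apply: entails_or; apply: entails_imp (entails_refl _) _;
  [exact: entails_orl|exact: entails_orr].
Qed.

Lemma equivalent_box_or (Var : Type) (a b : formula Var) :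
  equivalent (□ (a ∨ b)) (□ a ∨ □ b).
Proof.
split; first exact/MIDm_ax/ax_box_or.
by apply: entails_or; apply: entails_box;
  [exact: entails_orl|exact: entails_orr].
Qed.

Lemma equivalent_dia_or (Var : Type) (a b : formula Var) :
  equivalent (◇ (a ∨ b)) (◇ a ∨ ◇ b).
Proof.
split; first exact/MIDm_ax/ax_dia_or.
by apply: entails_or; apply: entails_dia;
  [exact: entails_orl|exact: entails_orr].
Qed.

Inductive normal (Var : Type) : formula Var -> Prop :=
| normal_classical a : classical a -> normal a
| normal_or a b : normal a -> normal b -> normal (a ∨ b).

Definition normalizable (Var : Type) (a : formula Var) : Prop :=
  exists2 d, normal d & equivalent a d.

Lemma normalizable_equivalent (Var : Type) (a b : formula Var) :
  equivalent a b -> normalizable b -> normalizable a.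
Proof.
by move=> ab [d nd bd]; exists d => //; exact: equivalent_trans bd.
Qed.

Lemma normalizable_classical (Var : Type) (a : formula Var) :
  classical a -> normalizable a.
Proof.
by exists a; [exact: normal_classical|split; exact: entails_refl].
Qed.

Lemma normalizable_or (Var : Type) (a b : formula Var) :
  normalizable a -> normalizable b -> normalizable (a ∨ b).
Proof.
move=> [d nd ad] [e ne be]; exists (d ∨ e); first exact: normal_or.
exact: equivalent_or.
Qed.

Lemma normalizable_and (Var : Type) (a b : formula Var) :
  normalizable a -> normalizable b -> normalizable (a ∧ b).
Proof.
move=> [d nd ad] [e ne be].
apply: normalizable_equivalent (equivalent_and ad be) _ => {a b ad be}.
elim: nd => {d} [d cd|d d' _ IHd _ IHd'].
  elim: ne => {e} [e ce|e e' _ IHe _ IHe'].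
    by apply: normalizable_classical; rewrite /= cd.
  apply: normalizable_equivalent (equivalent_and_orr _ _ _) _.
  exact: normalizable_or.
apply: normalizable_equivalent (equivalent_and_orl _ _ _) _.
exact: normalizable_or.
Qed.

(** The antecedent is decomposed first, because [ax_split] distributes over the consequent only
    under a classical antecedent. Each disjunction in the antecedent becomes a conjunction, hence
    the appeal to [normalizable_and]. *)
Lemma normalizable_imp (Var : Type) (a b : formula Var) :
  normalizable a -> normalizable b -> normalizable (a ⇒ b).
Proof.
move=> [d nd ad] [e ne be].
apply: normalizable_equivalent (equivalent_imp ad be) _ => {a b ad be}.
elim: nd => {d} [d cd|d d' _ IHd _ IHd'].
  elim: ne => {e} [e ce|e e' _ IHe _ IHe'].
    by apply: normalizable_classical; rewrite /= cd.
  apply: normalizable_equivalent (equivalent_imp_orr _ _ cd) _.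
  exact: normalizable_or.
apply: normalizable_equivalent (equivalent_imp_orl _ _ _) _.
exact: normalizable_and.
Qed.

Lemma normalizable_box (Var : Type) (a : formula Var) :
  normalizable a -> normalizable (□ a).
Proof.
move=> [d nd ad].
apply: normalizable_equivalent (equivalent_box ad) _ => {a ad}.
elim: nd => {d} [d cd|d e _ IHd _ IHe]; first exact: normalizable_classical.
apply: normalizable_equivalent (equivalent_box_or _ _) _.
exact: normalizable_or.
Qed.

Lemma normalizable_dia (Var : Type) (a : formula Var) :
  normalizable a -> normalizable (◇ a).
Proof.
move=> [d nd ad].
apply: normalizable_equivalent (equivalent_dia ad) _ => {a ad}.
elim: nd => {d} [d cd|d e _ IHd _ IHe]; first exact: normalizable_classical.
apply: normalizable_equivalent (equivalent_dia_or _ _) _.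
exact: normalizable_or.
Qed.

Lemma normal_form (Var : Type) (a : formula Var) : normalizable a.
Proof.
elim: a => [p||a IHa b IHb|a IHa b IHb|a IHa b IHb|a IHa|a IHa].
- exact: normalizable_classical.
- exact: normalizable_classical.
- exact: normalizable_and.
- exact: normalizable_or.
- exact: normalizable_imp.
- exact: normalizable_box.
- exact: normalizable_dia.
Qed.

(** * Maximal consistent sets *)

Definition mcs (Var : Type) (X : set (formula Var)) : Prop :=
  ~ derives X ⊥ /\ forall a, X a \/ X (¬ a).

Lemma mcs_derives (Var : Type) (X : set (formula Var)) (a : formula Var) :
  mcs X -> derives X a -> X a.
Proof.
move=> [consX /(_ a)[//|na] da]; case: consX.
exact: derives_mp (derives_hyp na) da.
Qed.

(** A derivation uses finitely many members of the chain, hence a single one. The first alternative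
    covers derivations that use none, as when the chain is empty. *)
Lemma derives_bigcup (Var : Type) (G : set (set (formula Var)))
    (X : set (formula Var)) (a : formula Var) : total_on G subset ->
  derives ((\bigcup_(Y in G) Y) `|` X) a ->
  derives X a \/ exists2 Y, G Y & derives (Y `|` X) a.
Proof.
move=> totG; elim=> {a} [a Ta|a [[Y GY Ya]|Xa]|a b _ IHab _ IHa].
- by left; exact: derives_thm.
- by right; exists Y => //; apply: derives_hyp; left.
- by left; exact: derives_hyp.
- case: IHab IHa => [ab|[Y GY ab]] [da|[Z GZ da]].
  + by left; exact: derives_mp da.
  + right; exists Z => //; apply: derives_mp da.
    by apply: derives_sub ab; exact: subsetUr.
  + right; exists Y => //; apply: derives_mp ab _.
    by apply: derives_sub da; exact: subsetUr.
  + right; case: (totG _ _ GY GZ) => [YZ|ZY]; [exists Z|exists Y] => //.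
      by apply: derives_mp da; apply: derives_sub ab; exact: setSU.
    by apply: derives_mp ab _; apply: derives_sub da; exact: setSU.
Qed.

(** A maximal [Y] refutes every formula it omits, so omitting both [a] and [¬ a] would derive [¬ a]
    and [¬ ¬ a]. This decides all formulas, classical or not, without double negation
    elimination. *)
Lemma lindenbaum (Var : Type) (X : set (formula Var)) :
  ~ derives X ⊥ -> exists2 Y, mcs Y & X `<=` Y.
Proof.
move=> consX.
have [G sG totG|Y [consY maxY]] :=
  (* Joining [X] inside the predicate lets it hold of the empty set, the union of the empty
     chain. *)
  Zorn_bigcup (P := [set Y | ~ derives (Y `|` X) ⊥]).
  by move=> /(derives_bigcup totG)[//|[Y /sG]].
have maxE Z : Y `<=` Z -> ~ derives (Z `|` X) ⊥ -> Z `<=` Y.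
  by move=> YZ consZ; apply: contrapT => nZY; exact: (maxY Z) consZ.
have XY : X `<=` Y.
  apply: subset_trans (maxE (Y `|` X) _ _); [exact: subsetUr|exact: subsetUl|].
  by rewrite -setUA setUid.
exists Y => //; have YX : Y `|` X = Y by apply/setUidPl.
move: consY; rewrite /= YX => consY; split=> // a.
have dec b : ~ Y b -> derives Y (¬ b).
  move=> nYb; apply: derives_imp; apply: contrapT => consb; apply: nYb.
  apply: (maxE (b |` Y)); [exact: subsetUr| |by left].
  by rewrite -setUA YX.
case: (pselect (Y a)) => [|na]; [by left|right].
apply: contrapT => /dec nna; apply: consY.
exact: derives_mp nna (dec a na).
Qed.

Lemma mcs_and (Var : Type) (X : set (formula Var)) (a b : formula Var) :
  mcs X -> X (a ∧ b) <-> X a /\ X b.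
Proof.
move=> mX; split=> [/derives_hyp dab|[/derives_hyp da /derives_hyp db]].
  split; apply: mcs_derives => //; apply: derives_mp dab; apply: derives_ax.
    exact: ax_andl.
  exact: ax_andr.
apply: mcs_derives => //; apply: derives_mp db; apply: derives_mp da.
exact/derives_ax/ax_and.
Qed.

Lemma mcs_imp (Var : Type) (X : set (formula Var)) (a b : formula Var) :
  mcs X -> X (a ⇒ b) <-> (X a -> X b).
Proof.
move=> mX; split=> [/derives_hyp dab /derives_hyp da|ab].
  exact: mcs_derives mX (derives_mp dab da).
apply: mcs_derives => //; apply: derives_imp.
case: (mX) => _ /(_ a)[/ab Xb|na]; first by apply: derives_hyp; right.
apply: derives_mp (derives_ax _ (ax_bot b)) _.
by apply: (derives_mp (a := a)); apply: derives_hyp; [right|left].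
Qed.

(** The inclusion of [box_inv X] in [Y] is the canonical accessibility relation. *)
Definition box_inv (Var : Type) (X : set (formula Var)) : set (formula Var) :=
  [set a | X (□ a)].

Lemma derives_box (Var : Type) (X : set (formula Var)) (a : formula Var) :
  derives (box_inv X) a -> derives X (□ a).
Proof.
elim=> {a} [a /MIDm_nec|a|a b _ IHab _ IHa].
- exact: derives_thm.
- by move=> Xa; apply: derives_hyp.
- apply: derives_mp IHa; apply: derives_mp IHab.
  exact/derives_ax/ax_box_imp.
Qed.

(** Inconsistency of [¬ a] with [box_inv X] yields only [¬ ¬ a] under the box; classicality of [a]
    removes the double negation. *)
Lemma mcs_box (Var : Type) (X : set (formula Var)) (a : formula Var) :
  classical a -> mcs X ->
  X (□ a) <-> forall Y, mcs Y -> box_inv X `<=` Y -> Y a.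
Proof.
move=> ca mX; split=> [Xa Y _|h]; first exact.
apply: contrapT => nXa; case: (@lindenbaum _ (¬ a |` box_inv X)) => [d|Y mY].
  apply: nXa; apply: (mcs_derives mX); apply: derives_box.
  by apply: derives_mp (derives_imp d); apply/derives_ax/ax_dne.
rewrite subUset => -[nYa /(h Y mY)/derives_hyp Ya]; apply: mY.1.
by apply: derives_mp Ya; apply/derives_hyp/nYa.
Qed.

Lemma mcs_dia (Var : Type) (X : set (formula Var)) (a : formula Var) :
  mcs X -> X (◇ a) <-> exists Y, [/\ mcs Y, box_inv X `<=` Y & Y a].
Proof.
move=> mX; split=> [/derives_hyp Xa|[Y [mY XY Ya]]].
  case: (@lindenbaum _ (a |` box_inv X)) => [d|Y mY].
    apply: mX.1; apply: derives_mp (derives_ax _ (ax_dia_bot _)) _.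
    apply: derives_mp Xa; apply: derives_mp (derives_box (derives_imp d)).
    exact/derives_ax/ax_dia_imp.
  by rewrite subUset => -[Ya XY]; exists Y; split=> //; exact: Ya.
(* If [◇ a] is not in [X], then [◇ a ⇒ □ ⊥] is, and [ax_dia_box] turns it into [□ ¬ a], which puts
   [¬ a] in [Y]. *)
apply: contrapT => nXa; apply: mY.1; apply: derives_mp (derives_hyp Ya).
apply: derives_hyp; apply: XY; rewrite /box_inv /=.
apply: mcs_derives => //; apply: derives_mp (derives_ax _ (ax_dia_box _ _)) _.
by apply: derives_hyp; apply/mcs_imp.
Qed.

(** * Team models over a set of states *)

(* Teams are predicates rather than elements of [set S]: the universe of [set]
   lies strictly above that of the worlds of a frame, because [class_M] is a
   [set] of models. *)
Definition team (S : Type) := {T : S -> Prop | exists s, T s}.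

Lemma team_eq (S : Type) (T U : team S) : sval T = sval U -> T = U.
Proof. by case: T U => [T ?] [U ?] /= TU; exact: eq_exist. Qed.

Lemma finite_team (S : Type) (F : finType) (f : S -> F) :
  injective f -> finite_set [set: team S].
Proof.
move=> f_inj.
pose g (T : team S) : {ffun F -> bool} :=
  [ffun x => `[< exists2 s, sval T s & f s = x >]].
have sub T U s : g T = g U -> sval T s -> sval U s.
  move=> /ffunP/(_ (f s)); rewrite !ffunE => TU Ts.
  have : `[< exists2 t, sval T t & f t = f s >].
    by apply/asboolP; exists s.
  by rewrite TU => /asboolP[t Ut /f_inj <-].
rewrite -(preimage_setT g); apply: finite_preimage finite_finset.
by move=> T U _ _ TU; apply/team_eq/seteqP; split=> s; exact: sub.
Qed.

Definition team_acc (S : Type) (r : S -> S -> Prop) (T U : team S) : Prop :=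
  (forall t, sval T t -> exists2 u, sval U u & r t u) /\
  (forall u, sval U u -> exists2 t, sval T t & r t u).

Lemma team_F1 (S : Type) (r : S -> S -> Prop) (T T' U : team S) :
  sval T' `<=` sval T -> team_acc r T U ->
  exists2 U' : team S, sval U' `<=` sval U & team_acc r T' U'.
Proof.
move=> sT [TU UT]; have [t0 Tt0] := svalP T'.
have [u0 Uu0 tu0] := TU _ (sT _ Tt0).
have ne : [set u | sval U u /\ exists2 t, sval T' t & r t u] !=set0.
  by exists u0; split=> //; exists t0.
exists (exist _ _ ne) => /= [u []//|]; split=> /= [t Tt|u []//].
by have [u Uu tu] := TU _ (sT _ Tt); exists u => //; split=> //; exists t.
Qed.

(** The Egli-Milner lifting of the converse of [r] is the converse of the lifting, so this is
    [team_F1] for the converse relation. *)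
Lemma team_F2 (S : Type) (r : S -> S -> Prop) (T U U' : team S) :
  team_acc r T U -> sval U' `<=` sval U ->
  exists2 T' : team S, sval T' `<=` sval T & team_acc r T' U'.
Proof.
move=> [TU UT] sU.
have [|T' sT' [TU' UT']] := @team_F1 _ (fun u t => r t u) U U' T sU.
  by split.
by exists T'.
Qed.

Definition team1 (S : Type) (s : S) : team S :=
  exist _ (fun t => t = s) (ex_intro _ s erefl).

Definition team_frame (S : Type) (r : S -> S -> Prop) (s0 : S) : frame.
Proof.
refine (@Frame (team S) _ (fun T U => sval U `<=` sval T) _ _ _
  (team_acc r) _ _).
- by exists (team1 s0).
- by move=> T.
- by move=> T U V TU UV; exact: subset_trans TU.
- by move=> T U TU UT; apply/team_eq/seteqP.
- exact: team_F1.
- exact: team_F2.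
Defined.

Definition team_model (Var S : Type) (r : S -> S -> Prop) (s0 : S)
  (v : Var -> set S) : model Var.
Proof.
refine (@Model Var (team_frame r s0) (fun p => [set T | sval T `<=` v p]) _).
by move=> p T U Tp UT; exact: subset_trans Tp.
Defined.

Lemma team_endpointP (S : Type) (r : S -> S -> Prop) (s0 : S)
    (T : team_frame r s0) : endpoint T <-> exists s, T = team1 s.
Proof.
split=> [hT|[s ->] [U nU sU]].
  have [s Ts] := svalP T; exists s.
  by apply/esym/(endpoint_eq hT) => _ ->.
apply/nU/team_eq/seteqP; split=> // _ ->.
by have [t Ut] := svalP U; rewrite -(sU _ Ut).
Qed.

Lemma team_endpoints_belowP (S : Type) (r : S -> S -> Prop) (s0 : S)
    (T e : team_frame r s0) :
  endpoints_below T e <-> exists2 s, sval T s & e = team1 s.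
Proof.
split=> [[Te /team_endpointP[s es]]|[s Ts ->]].
  by exists s => //; apply: Te; rewrite es.
by split=> [_ ->//|]; apply/team_endpointP; exists s.
Qed.

(** Passing below [T] discards the states without a successor in [U], so only the backward half of
    the lifting remains. *)
Lemma team_above_acc (S : Type) (r : S -> S -> Prop) (s0 : S)
    (T U : team_frame r s0) :
  above_acc T U <-> forall u, sval U u -> exists2 t, sval T t & r t u.
Proof.
split=> [[Z TZ [_ ZU]] u /ZU[t Zt tu]|TU].
  by exists t => //; exact: TZ.
have ne : [set t | sval T t /\ exists2 u, sval U u & r t u] !=set0.
  have [u Uu] := svalP U; have [t Tt tu] := TU u Uu.
  by exists t; split=> //; exists u.
exists (exist _ _ ne) => [t []//|]; split=> [t []//|u Uu] /=.
by have [t Tt tu] := TU u Uu; exists t => //; split=> //; exists u.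
Qed.

(** Endpoints are the singleton teams, so a set of endpoints amounts to a set of states. Saturation
    and (G2) take the team of states whose singletons lie in [E], and (G1) takes the union of the
    teams in [X]. Negativity holds because a team satisfies an atom iff each of its members does. *)
Lemma team_model_class (Var S : Type) (F : finType) (f : S -> F)
    (r : S -> S -> Prop) (s0 : S) (v : Var -> set S) :
  injective f -> class_M (team_model r s0 v).
Proof.
move=> f_inj; split.
- exact: finite_team f_inj.
- move=> T p; split=> [pT U TU nU|nnT].
    apply: (nU U) => // u Uu.
    by apply: pT; exact: TU.
  move=> s Ts; apply: contrapT => ns.
  apply: (nnT (team1 s)) => [_ ->//|U Us pU].
  have [u Uu] := svalP U.
  by apply: ns; rewrite -(Us _ Uu); exact: pU.
- move=> T; split.
    have [s Ts] := svalP T; exists (team1 s).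
    by apply/team_endpoints_belowP; exists s.
  move=> E [e Ee] ET.
  have ne : [set s | E (team1 s)] !=set0.
    by have /team_endpoints_belowP[s _ es] := ET e Ee; exists s; rewrite /= -es.
  exists (exist _ _ ne).
    move=> s /ET /team_endpoints_belowP[t Tt].
    by move=> /(congr1 sval)/= /seteqP[/(_ s erefl) ->].
  apply/seteqP; split=> [x /team_endpoints_belowP[s Es ->]//|x Ex].
  apply/team_endpoints_belowP.
  by have /team_endpoints_belowP[s _ es] := ET x Ex; exists s; rewrite //= -es.
- move=> T X [x0 Xx0] _ XT.
  have ne : [set s | exists2 x : team_frame r s0, X x & sval x s] !=set0.
    by have [s xs] := svalP x0; exists s; exists x0.
  exists (exist _ _ ne) => [|x Xx s xs]; last by exists x.
  apply/team_above_acc => u [x /XT /team_above_acc xT xu]; exact: xT.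
- move=> T E Eend ET TE.
  have ET1 t : sval T t -> exists2 s, E (team1 s) & r t s.
    move=> Tt; have [|e [Ee [_ -> [te _]]]] := TE (team1 t).
      by apply/team_endpoints_belowP; exists t.
    have /team_endpointP[s es] := Eend e Ee.
    have [s' es' ts] := te t erefl.
    by exists s; rewrite -?es//; move: es' ts; rewrite es => ->.
  have ne : [set s | E (team1 s)] !=set0.
    by have [t Tt] := svalP T; have [s] := ET1 t Tt; exists s.
  exists (exist _ _ ne); last by move=> x /team_endpoints_belowP[s Es ->].
  split=> [t /ET1//|s /ET[a /team_endpoints_belowP[t Tt ->] [_ ts]]].
  by exists t => //; have [_ -> ] := ts s erefl.
Qed.

(** * Filtration of the canonical model and completeness *)

HB.instance Definition _ (Var : Type) := gen_eqMixin (formula Var).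

Fixpoint subformulas (Var : Type) (a : formula Var) : seq (formula Var) :=
  a :: match a with
       | Atom _ | Bot => [::]
       | And b c | Or b c | Imp b c => subformulas b ++ subformulas c
       | Box b | Dia b => subformulas b
       end.

Lemma subformulas_refl (Var : Type) (a : formula Var) : a \in subformulas a.
Proof. by case: a => *; rewrite mem_head. Qed.

(* Not [n.-tuple bool], whose universe is too large for a type of worlds. *)
Definition state (n : nat) := {s : seq bool | size s == n}.

Definition state_tuple (n : nat) (s : state n) : n.-tuple bool :=
  Tuple (svalP s).

Lemma state_tuple_inj (n : nat) : injective (@state_tuple n).
Proof. by case=> s hs [t ht] /(congr1 val)/= st; exact: eq_exist. Qed.

Lemma size_signature (Var : Type) (G : seq (formula Var))
  (X : set (formula Var)) : size [seq `[< X a >] | a <- G] == size G.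
Proof. by rewrite size_map. Qed.

(** The filtration class of [X], coded by its membership bits on [G]. *)
Definition signature (Var : Type) (G : seq (formula Var))
    (X : set (formula Var)) : state (size G) :=
  exist _ [seq `[< X a >] | a <- G] (size_signature G X).

Lemma signature_eq (Var : Type) (G : seq (formula Var))
    (X Y : set (formula Var)) (a : formula Var) :
  signature G X = signature G Y -> a \in G -> X a -> Y a.
Proof.
by move=> /(congr1 sval)/= /eq_in_map XY /XY e Xa; apply/asboolP; rewrite -e;
  apply/asboolP.
Qed.

(** The least filtration: two classes are related when some representatives are. *)
Definition canonical_rel (Var : Type) (G : seq (formula Var))
    (s t : state (size G)) : Prop :=
  exists X Y, [/\ mcs X, mcs Y, box_inv X `<=` Y, signature G X = s
    & signature G Y = t].

Definition canonical_model (Var : Type) (G : seq (formula Var)) : model Var :=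
  team_model (@canonical_rel _ G) (signature G set0)
    (fun p => [set s | exists2 X, mcs X /\ signature G X = s & X (Atom p)]).

(** The states are all bit lists of the right length, and some may be the signature of no maximal
    consistent set. The truth lemma is limited to teams avoiding those. *)
Definition realized (Var : Type) (G : seq (formula Var))
    (T : canonical_model G) : Prop :=
  forall s, sval T s -> exists2 X, mcs X & signature G X = s.

Lemma realized_acc (Var : Type) (G : seq (formula Var))
  (T U : canonical_model G) : acc T U -> realized U.
Proof.
by move=> [_ UT] u /UT[t _ [X [Y [_ mY _ _ Yu]]]]; exists Y.
Qed.

Lemma realized_team1 (Var : Type) (G : seq (formula Var))
    (X : set (formula Var)) :
  mcs X -> @realized _ G (team1 (signature G X)).
Proof. by move=> mX _ ->; exists X. Qed.

(** Truth is evaluated memberwise: implication and box are tested on singleton teams. Since [G]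
    contains all subformulas, [signature_eq] moves membership between representatives of one
    state. *)
Lemma truth (Var : Type) (G : seq (formula Var)) (a : formula Var) :
  classical a -> {subset subformulas a <= G} ->
  forall T : canonical_model G, realized T ->
  sat T a <-> forall X, mcs X -> sval T (signature G X) -> X a.
Proof.
move=> + aG; have Ga := aG a (subformulas_refl a).
elim: a aG Ga => [p||a IHa b IHb|//|a IHa b IHb|a IHa|a IHa] aG Ga /=.
- move=> _ T rT; split=> [Tp X mX /Tp[Y [mY YX] Yp]|h s Ts].
    exact: signature_eq YX Ga Yp.
  by have [X mX Xs] := rT s Ts; exists X => //; apply: h; rewrite ?Xs.
- move=> _ T rT; split=> // h; have [s Ts] := svalP T.
  have [X mX Xs] := rT s Ts; apply: mX.1; apply: derives_hyp.
  by apply: h; rewrite ?Xs.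
- have [aG' bG'] : {subset subformulas a <= G} /\ {subset subformulas b <= G}.
    by split=> x xs; apply: aG; rewrite inE mem_cat xs ?orbT.
  move=> /andP[ca cb] T rT.
  have {}IHa := IHa aG' (aG' _ (subformulas_refl a)) ca T rT.
  have {}IHb := IHb bG' (bG' _ (subformulas_refl b)) cb T rT.
  split=> [[/IHa ha /IHb hb] X mX TX|h].
    by apply/mcs_and => //; split; [exact: ha|exact: hb].
  by split; [apply/IHa|apply/IHb] => X mX TX;
    have /mcs_and[] := h X mX TX.
- have [aG' bG'] : {subset subformulas a <= G} /\ {subset subformulas b <= G}.
    by split=> x xs; apply: aG; rewrite inE mem_cat xs ?orbT.
  move=> /andP[ca cb] T rT.
  have {}IHa := IHa aG' (aG' _ (subformulas_refl a)) ca.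
  have {}IHb := IHb bG' (bG' _ (subformulas_refl b)) cb.
  split=> [h X mX TX|h U UT Ua].
    apply/mcs_imp => // Xa; have rX := @realized_team1 _ G X mX.
    have /(IHb _ rX) : sat (team1 (signature G X) : canonical_model G) b.
      apply: h => [_ ->//|]; apply/IHa => // Y mY YX.
      exact: signature_eq (esym YX) (aG' _ (subformulas_refl a)) Xa.
    by apply.
  have rU : realized U by move=> s /UT /rT.
  apply/IHb => // X mX UX.
  have /mcs_imp : X (a ⇒ b) by apply: h => //; exact: UT.
  by apply=> //; move/(IHa U rU): Ua; exact.
- have aG' : {subset subformulas a <= G}.
    by move=> x xs; apply: aG; rewrite inE xs orbT.
  move=> ca T rT; have {}IHa := IHa aG' (aG' _ (subformulas_refl a)) ca.
  split=> [h X mX TX|h U U' TU UU'].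
    apply/mcs_box => // Y mY XY.
    have /(IHa _ (realized_team1 mY)) :
        sat (team1 (signature G Y) : canonical_model G) a.
      apply: (h (team1 (signature G X))) => [_ ->//|].
      have XYr : canonical_rel (signature G X) (signature G Y) by exists X, Y.
      by split=> [_ ->|_ ->]; [exists (signature G Y)|exists (signature G X)].
    by apply.
  apply/(IHa _ (realized_acc UU')) => Y mY /(UU'.2)[t /TU Tt].
  case=> X0 [Y0 [mX0 mY0 XY0 X0t Y0Y]].
  apply: signature_eq Y0Y (aG' _ (subformulas_refl a)) _.
  by apply: XY0; apply: h => //; rewrite X0t.
- have aG' : {subset subformulas a <= G}.
    by move=> x xs; apply: aG; rewrite inE xs orbT.
  have aa := aG' _ (subformulas_refl a).
  move=> ca T rT; have {}IHa := IHa aG' aa ca.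
  split=> [[U TU /(IHa _ (realized_acc TU)) Ua] X mX TX|h].
    have [u Uu [X0 [Y0 [mX0 mY0 XY0 X0X Y0u]]]] := TU.1 _ TX.
    apply: signature_eq X0X Ga _; apply/mcs_dia => //.
    by exists Y0; split=> //; apply: Ua => //; rewrite Y0u.
  (* The diamond's witness collects the states of all canonical successors containing [a], over
     every representative of a state in [T]. *)
  pose succ u := exists X Y, [/\ mcs X, sval T (signature G X), mcs Y,
    box_inv X `<=` Y & Y a /\ signature G Y = u].
  have next t : sval T t -> exists2 u, succ u & canonical_rel t u.
    move=> Tt; have [X mX Xt] := rT t Tt; rewrite -Xt in Tt.
    have /(mcs_dia _ mX)[Y [mY XY Ya]] := h X mX Tt.
    by exists (signature G Y); exists X, Y.
  have ne : exists u, succ u.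
    by have [t Tt] := svalP T; have [u] := next t Tt; exists u.
  have TU : @acc (canonical_model G) T (exist _ succ ne).
    split=> [//|_ [X [Y [mX TX mY XY [Ya <-]]]]].
    by exists (signature G X) => //; exists X, Y.
  exists (exist _ succ ne) => //.
  apply/(IHa _ (realized_acc TU)) => Z mZ [X [Y [_ _ _ _ [Ya YZ]]]].
  exact: signature_eq YZ aa Ya.
Qed.

(** The list [G] stays fixed through the induction so that the teams refuting the two disjuncts live
    in one model and can be united. *)
Lemma normal_refutation (Var : Type) (G : seq (formula Var))
    (d : formula Var) : normal d -> {subset subformulas d <= G} -> ~ MIDm d ->
  exists2 T : canonical_model G, realized T & ~ sat T d.
Proof.
elim=> {d} [a ca aG na|a b _ IHa _ IHb abG nab].
  have [d|X mX] := @lindenbaum _ [set ¬ a].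
    apply: na; apply: MIDm_mp (MIDm_ax (ax_dne ca)) _.
    by apply: derives_set0; apply: derives_imp; rewrite setU0.
  move=> /(_ (¬ a) erefl) Xna; exists (team1 (signature G X)).
    exact: realized_team1.
  move=> /(truth ca aG (realized_team1 mX))/(_ X mX erefl)/derives_hyp Xa.
  by apply: mX.1; apply: derives_mp Xa; exact: derives_hyp.
have [||T rT Ta] := IHa.
- by move=> x xs; apply: abG; rewrite inE mem_cat xs orbT.
- by move=> pa; apply: nab; exact: MIDm_mp (MIDm_ax (ax_orl a b)) pa.
have [||U rU Ub] := IHb.
- by move=> x xs; apply: abG; rewrite inE mem_cat xs !orbT.
- by move=> pb; apply: nab; exact: MIDm_mp (MIDm_ax (ax_orr a b)) pb.
have ne : exists s, (sval T `|` sval U) s.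
  by have [s Ts] := svalP T; exists s; left.
exists (exist _ _ ne); first by move=> s [/rT|/rU].
by case=> [sa|sb]; [apply: Ta; apply: sat_persistent sa => s; left
  |apply: Ub; apply: sat_persistent sb => s; right].
Qed.

Theorem theorem3p7 (Var : Type) (phi : formula Var) :
  MIDm phi <->
  forall M : model Var, class_M M -> forall w : M, sat w phi.
Proof.
split=> [|valid]; first exact: soundness.
have [d nd [phid dphi]] := normal_form phi.
apply: MIDm_mp dphi _; apply: contrapT => nd'.
have [//|T _] := normal_refutation (G := subformulas d) nd _ nd'.
have cM : class_M (canonical_model (subformulas d)).
  exact: team_model_class (@state_tuple_inj _).
(* Validity gives [phi] at [T], and soundness of the theorem [phi ⇒ d] turns it into [d], which [T]
   refutes. *)
apply; have /= phidT := soundness phid cM T.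
exact: phidT T (above_refl T) (valid _ cM T).
Qed.
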